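(* In $M^{S\mathbb{E}}$ there exist at most 4 congruence classes of 3-point equally spaced ordinary meshes with curvature $\kappa$ and distance $\mathsf d_{-}$, as follows: - If $\kappa\cdot\mathsf d_{-}=2$, there are 2 congruence classes: one in $SD$, denoted by $\gamma^{\vartriangle}_{\kappa,SD}$, and another in $\sim SD$, denoted by $\gamma^{\vartriangle}_{\kappa,\sim SD}$. - If $\kappa\cdot\mathsf d_{-}\neq 2$, there are 4 congruence classes: two in $SD$, denoted by $\{\gamma^{\vartriangle,1}_{\kappa,\mathsf d_{-},SD},\gamma^{\vartriangle,2}_{\kappa,\mathsf d_{-},SD}\}$, and the other two in $\sim SD$, denoted by $\{\gamma^{\vartriangle,1}_{\kappa,\mathsf d_{-},\sim SD},\gamma^{\vartriangle,2}_{\kappa,\mathsf d_{-},\sim SD}\}$.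
   Context: $M^{S\mathbb{E}}$ is the space of all planar ordinary meshes acted on by $S\mathbb{E}(2)=SO(2)\ltimes\mathbb{R}^2$. A 3-point mesh is an ordered triple $\{p_1,p,p_2\}$ of successive points of $\mathbb{R}^2$; it is ordinary if it has no cusp, i.e. $p_1\neq p_2$, and equally spaced if $|p_1-p|=|p-p_2|$. The distance $\mathsf d_{-}=|p_1-p_2|$ is the Euclidean distance between the first and end points. Two meshes $\{p_1,p,p_2\}$, $\{q_1,q,q_2\}$ are congruent if some $g\in S\mathbb{E}(2)$ satisfies $g\cdot p_1=q_1$, $g\cdot p=q$, $g\cdot p_2=q_2$. The (2-point Euclidean) curvature is $\kappa=\frac{4\Delta}{abc}$, where $a,b,c$ are the Euclidean distances between the three points and $\Delta$ is the area of the triangle with vertices $p_1,p,p_2$. The mesh is in $SD$ (the signature-direction) if $p_1,p,p_2$ are in counterclockwise order on their circumcircle, and in $\sim SD$ otherwise.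
   Formalization: The claim of 4 classes when κ·d₋≠2 fails for κ·d₋>2 (e.g. κ=1, d₋=3: no mesh) and κ=0 (one flat class); the bullets are stated for κ,d₋>0, with 4 classes when κ·d₋<2 and none when κ·d₋>2; ''at most 4'' is kept for all κ, d₋. *)

(* Defs.v *)
From mathcomp Require Export all_boot all_order all_algebra.
From mathcomp Require Export all_classical all_reals all_analysis.

Set Implicit Arguments.
Unset Strict Implicit.
Unset Printing Implicit Defensive.

Import Order.TTheory GRing.Theory Num.Theory.

Local Open Scope classical_set_scope.
Local Open Scope ring_scope.

Section PlanarMeshes.
Variable R : realType.

Definition point := 'cV[R]_2.

(* The library norm on 'cV[R]_2 is the sup norm, so the Euclidean distance is
   spelled out. *)
Definition edist (p q : point) : R :=
  Num.sqrt (\sum_(i < 2) (p i 0 - q i 0) ^+ 2).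

Definition area (p q s : point) : R :=
  `|\det (row_mx (q - p) (s - p) : 'M[R]_2)| / 2.

Record mesh := Mesh { pfirst : point; pmid : point; plast : point }.

Definition ordinary (m : mesh) : Prop := pfirst m <> plast m.

Definition equally_spaced (m : mesh) : Prop :=
  edist (pfirst m) (pmid m) = edist (pmid m) (plast m).

Definition distance (m : mesh) : R := edist (pfirst m) (plast m).

Definition curvature (m : mesh) : R :=
  4 * area (pfirst m) (pmid m) (plast m) /
    (edist (pfirst m) (pmid m) * edist (pmid m) (plast m)
       * edist (pfirst m) (plast m)).

Definition SO2 : set 'M[R]_2 := [set A | A *m A^T = 1%:M /\ \det A = 1].

(* SE(2) = SO(2) |x R^2; the pair (A, t) acts on the plane by p |-> A p + t. *)
Definition SE2 : set ('M[R]_2 * point) := [set g | SO2 g.1].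

Definition act (g : 'M[R]_2 * point) (p : point) : point := g.1 *m p + g.2.

Definition congruent (m m' : mesh) : Prop :=
  exists g, [/\ SE2 g, act g (pfirst m) = pfirst m', act g (pmid m) = pmid m'
              & act g (plast m) = plast m'].

Definition congruence_class (m : mesh) : set mesh := [set m' | congruent m m'].

Definition circle_point (c : point) (r theta : R) : point :=
  c + r *: \col_(i < 2) (if i == 0 then cos theta else sin theta).

(* Three distinct points lie on at most one circle, so c and r are the circumcentre
   and circumradius. Starting at the first point and going counterclockwise, less than one full
   turn, one meets the middle point and then the last one. *)
Definition SD : set mesh := [set m |
  exists (c : point) (r t1 t t2 : R),
    [/\ 0 < r, [/\ t1 < t, t < t2 & t2 < t1 + 2 * pi],
        pfirst m = circle_point c r t1, pmid m = circle_point c r t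
      & plast m = circle_point c r t2]].

Definition meshes (kappa d : R) : set mesh := [set m |
  [/\ ordinary m, equally_spaced m, curvature m = kappa & distance m = d]].

Definition classes (kappa d : R) : set (set mesh) :=
  [set congruence_class m | m in meshes kappa d].

Definition classes_in (S : set mesh) (kappa d : R) : set (set mesh) :=
  [set C | classes kappa d C /\ C `<=` S].

End PlanarMeshes.
Arguments SD {R}.

(* Main.v *)
Require Import Defs.
From mathcomp Require Import finmap ring lra.
Set Implicit Arguments.
Unset Strict Implicit.
Unset Printing Implicit Defensive.
Import Order.TTheory GRing.Theory Num.Theory.
Local Open Scope classical_set_scope.
Local Open Scope card_scope.
Local Open Scope ring_scope.

(** An equally spaced ordinary mesh is an isosceles triangle, possibly
degenerate, with an ordered base. Up to an orientation-preserving motion it is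
determined by its base [d] and its signed height [h], the doubled signed area
divided by [d]: these two numbers give the three side lengths, and the sign of
the area excludes reflections ([congruentP], [class_of_mesh], [class_of_inj]).

The squared equal side is [(d / 2)^2 + h^2] ([side_sqr]), so the curvature is
[2 |h| / ((d / 2)^2 + h^2)], and the congruence classes with curvature [kappa]
and distance [d] correspond one to one to the solutions [h] of
[kappa ((d / 2)^2 + h^2) = 2 |h|] ([classesE]). For positive [kappa] this reads
[(kappa |h| - 1)^2 = 1 - (kappa d / 2)^2] ([heights_gap]). Thus [|h|] has two
positive values when [kappa d < 2], one when [kappa d = 2] and none when
[kappa d > 2]. Geometrically, the circumradius is [1 / kappa], the chord [d]
cannot exceed the diameter [2 / kappa], and a chord shorter than the diameter
cuts the circle into two unequal arcs, each with its own midpoint as apex.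

Each value of [|h|] gives two classes, one for each sign of [h], and the sign
tells whether the class is in [SD]: three points met in counterclockwise order
on a circle are exactly those that span a positive area ([SD_orient]), by the
product formula [cross_circle_points] for that area. *)

(** * Plane vectors, rotations and congruence *)

Section Plane.
Variable R : realType.
Implicit Types (u v p q : point R) (m : mesh R).

Definition vec (x y : R) : point R := \col_i (if i == 0 then x else y).

Lemma vec_x x y : vec x y 0 0 = x. Proof. by rewrite mxE. Qed.

Lemma vec_y x y : vec x y 1 0 = y. Proof. by rewrite mxE. Qed.

Lemma pointP u v : u 0 0 = v 0 0 -> u 1 0 = v 1 0 -> u = v.
Proof.
move=> e0 e1; apply/colP => -[[|[|//]] lti].
- by rewrite (_ : Ordinal lti = 0) //; apply/val_inj.
- by rewrite (_ : Ordinal lti = 1) //; apply/val_inj.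
Qed.

Definition dot u v : R := u 0 0 * v 0 0 + u 1 0 * v 1 0.
Definition cross u v : R := u 0 0 * v 1 0 - u 1 0 * v 0 0.

Lemma det_mx22 (A : 'M[R]_2) : \det A = A 0 0 * A 1 1 - A 0 1 * A 1 0.
Proof.
rewrite (expand_det_row _ 0) !big_ord_recl big_ord0 /cofactor !det_mx11 !mxE /=.
have e1 : lift 0 0 = 1 :> 'I_2 by apply/val_inj.
have e2 : lift 1 0 = 0 :> 'I_2 by apply/val_inj.
by rewrite !e1 ?e2 /= /bump /= expr0 expr1; ring.
Qed.

Lemma sum2 (F : 'I_2 -> R) : \sum_(i < 2) F i = F 0 + F 1.
Proof.
by rewrite !big_ord_recl big_ord0 addr0; congr (_ + F _); apply/val_inj.
Qed.

Lemma row_mx_col0 u v i : (row_mx u v : 'M[R]_2) i 0 = u i 0.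
Proof. by rewrite -(row_mxEl u v); congr (_ _ _); apply/val_inj. Qed.

Lemma row_mx_col1 u v i : (row_mx u v : 'M[R]_2) i 1 = v i 0.
Proof. by rewrite -(row_mxEr u v); congr (_ _ _); apply/val_inj. Qed.

Lemma det_row_mx u v : \det (row_mx u v : 'M[R]_2) = cross u v.
Proof.
rewrite det_mx22 /cross.
by rewrite !row_mx_col0 !row_mx_col1; ring.
Qed.

Lemma edistE p q : edist p q = Num.sqrt (dot (p - q) (p - q)).
Proof. by rewrite /edist sum2 /dot !mxE -!expr2. Qed.

Lemma dot_ge0 u : 0 <= dot u u.
Proof. by rewrite /dot -!expr2 addr_ge0 ?sqr_ge0. Qed.

Lemma dot_eq0 u : (dot u u == 0) = (u == 0).
Proof.
apply/eqP/eqP => [|->]; last by rewrite /dot !mxE; ring.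
move/eqP; rewrite /dot -!expr2 paddr_eq0 ?sqr_ge0 // !sqrf_eq0.
move=> /andP[/eqP e0 /eqP e1].
by apply: pointP; rewrite mxE.
Qed.

Lemma edist_ge0 p q : 0 <= edist p q.
Proof. by rewrite edistE sqrtr_ge0. Qed.

Lemma edist_sqr p q : edist p q ^+ 2 = dot (p - q) (p - q).
Proof. by rewrite edistE sqr_sqrtr ?dot_ge0. Qed.

Lemma edist_eq p q p' q' :
  dot (p - q) (p - q) = dot (p' - q') (p' - q') -> edist p q = edist p' q'.
Proof. by rewrite !edistE => ->. Qed.

Lemma lagrange u v : dot u v ^+ 2 + cross u v ^+ 2 = dot u u * dot v v.
Proof. by rewrite /dot /cross; ring. Qed.

(** Twice the signed area of the triangle; its sign tells on which side of the
chord the middle point lies. *)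
Definition orient m : R := cross (pmid m - pfirst m) (plast m - pfirst m).

Lemma distance_gt0 m : ordinary m -> 0 < distance m.
Proof.
move=> om; rewrite /distance edistE sqrtr_gt0 lt0r dot_ge0 dot_eq0 andbT subr_eq0.
exact/eqP.
Qed.

Definition rotation (c s : R) : 'M[R]_2 :=
  row_mx (vec c s) (vec (- s) c) : 'M[R]_2.

Lemma rotation_mul c s u :
  rotation c s *m u = vec (c * u 0 0 - s * u 1 0) (s * u 0 0 + c * u 1 0).
Proof.
apply: pointP; rewrite mxE sum2 /rotation !row_mx_col0 !row_mx_col1;
  by rewrite ?vec_x ?vec_y; ring.
Qed.

Lemma rotation_SO2 c s : c ^+ 2 + s ^+ 2 = 1 -> SO2 (rotation c s).
Proof.
move=> cs; split; last by rewrite det_row_mx /cross ?vec_x ?vec_y -cs; ring.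
apply/matrixP => i j; rewrite mxE sum2 ![_^T _ _]mxE /rotation.
rewrite !row_mx_col0 !row_mx_col1 !mxE.
by case: i => [[|[|]]] // ?; case: j => [[|[|]]] // ? /=; rewrite -?cs; ring.
Qed.

Lemma SO2_dot (A : 'M[R]_2) u v : SO2 A -> dot (A *m u) (A *m v) = dot u v.
Proof.
move=> [/mulmx1C AA _].
have E (a b : point R) : dot a b = (a^T *m b) 0 0 by rewrite mxE sum2 !mxE.
by rewrite !E trmx_mul -mulmxA [_ *m (_ *m v)]mulmxA AA mul1mx.
Qed.

Lemma SO2_cross (A : 'M[R]_2) u v :
  SO2 A -> cross (A *m u) (A *m v) = cross u v.
Proof. by move=> [_ dA]; rewrite -!det_row_mx -mul_mx_row det_mulmx dA mul1r. Qed.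

(** In the orthogonal frame given by [v] and its quarter turn, a vector [u] has
coordinates [dot u v] and [cross v u], up to the factor [dot v v].  Hence the
rotation that carries [v] to [v'] must carry [u] to the vector [u'] with the
same two products.  Its cosine and sine are the dot and cross products of [v]
and [v'], divided by the squared length, and the Lagrange identity says that
their squares sum to one. *)
Lemma rotation_exists u v u' v' : v != 0 ->
  dot u v = dot u' v' -> dot v v = dot v' v' -> cross u v = cross u' v' ->
  exists A : 'M[R]_2, [/\ SO2 A, A *m u = u' & A *m v = v'].
Proof.
rewrite -dot_eq0; move De : (dot v v) => D D0 uv /esym vv uxv.
have L := lagrange v v'; rewrite De vv in L.
exists (rotation (dot v v' / D) (cross v v' / D)); split.
- apply: rotation_SO2; rewrite !expr_div_n -mulrDl L.
  by rewrite -expr2 divff ?expf_neq0.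
- rewrite rotation_mul; apply: pointP; rewrite ?vec_x ?vec_y; apply: (mulfI D0).
    have -> : D * (dot v v' / D * u 0 0 - cross v v' / D * u 1 0)
              = v' 0 0 * dot u v + v' 1 0 * cross u v.
      by rewrite /dot /cross; field.
    by rewrite uv uxv -vv /dot /cross; ring.
  have -> : D * (cross v v' / D * u 0 0 + dot v v' / D * u 1 0)
            = v' 1 0 * dot u v - v' 0 0 * cross u v.
    by rewrite /dot /cross; field.
  by rewrite uv uxv -vv /dot /cross; ring.
- rewrite rotation_mul; apply: pointP; rewrite ?vec_x ?vec_y; apply: (mulfI D0).
    have -> : D * (dot v v' / D * v 0 0 - cross v v' / D * v 1 0)
              = v' 0 0 * dot v v by rewrite /dot /cross; field.
    by rewrite De mulrC.
  have -> : D * (cross v v' / D * v 0 0 + dot v v' / D * v 1 0)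
            = v' 1 0 * dot v v by rewrite /dot /cross; field.
  by rewrite De mulrC.
Qed.

(** The law of cosines. *)
Lemma dot_side p q s :
  2 * dot (q - p) (s - p)
  = edist p q ^+ 2 + edist p s ^+ 2 - edist q s ^+ 2.
Proof. by rewrite !edist_sqr /dot !mxE; ring. Qed.

(** Side-side-side congruence for the orientation-preserving group: the three
side lengths fix the triangle up to a reflection, and the signed area removes
that last ambiguity. Congruence thus becomes an equality of invariants. *)
Lemma congruentP m m' : ordinary m ->
  congruent m m' <->
  [/\ edist (pfirst m) (pmid m) = edist (pfirst m') (pmid m'),
      edist (pmid m) (plast m) = edist (pmid m') (plast m'),
      distance m = distance m' & orient m = orient m'].
Proof.
case: m m' => [p1 p p2] [q1 q q2] /= om; split.
  move=> [[A t] [/= SA <- <- <-]].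
  have B a b : act (A, t) a - act (A, t) b = A *m (a - b).
    by rewrite /act /= mulmxBr opprD addrACA subrr addr0.
  split; try by apply: edist_eq; rewrite !B SO2_dot.
  by rewrite /orient /= !B SO2_cross.
case=> /= e1 e2 e3 e4.
have v0 : p2 - p1 != 0 by rewrite subr_eq0; apply/eqP => e; apply: om.
have uv : dot (p - p1) (p2 - p1) = dot (q - q1) (q2 - q1).
  have /= := dot_side p1 p p2; have /= := dot_side q1 q q2.
  rewrite /distance /= in e3; rewrite e1 e2 e3 => <- /mulfI; apply.
  by rewrite pnatr_eq0.
have vv : dot (p2 - p1) (p2 - p1) = dot (q2 - q1) (q2 - q1).
  have H a b : dot (a - b) (a - b) = dot (b - a) (b - a).
    by rewrite /dot !mxE; ring.
  by rewrite H [RHS]H -!edist_sqr; congr (_ ^+ 2).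
have [A [SA Au Av]] := rotation_exists v0 uv vv e4.
exists (A, q1 - A *m p1); split => //; rewrite /act /=.
- by rewrite addrC subrK.
- by rewrite addrCA -mulmxBr Au addrC subrK.
- by rewrite addrCA -mulmxBr Av addrC subrK.
Qed.

Lemma congruence_class_eq m m' : ordinary m -> ordinary m' -> congruent m m' ->
  congruence_class m = congruence_class m'.
Proof.
move=> om om' /(congruentP _ om)[e1 e2 e3 e4].
apply/seteqP; split=> n; rewrite /congruence_class /= !congruentP //;
  by rewrite e1 e2 e3 e4.
Qed.

End Plane.

(** * Counterclockwise order and the sign of the area *)

Section Circles.
Variable R : realType.
Implicit Types (u v p q s : point R) (m : mesh R).

Lemma circle_pointE (c : point R) r t :
  circle_point c r t = c + vec (r * cos t) (r * sin t).
Proof. by apply: pointP; rewrite !mxE. Qed.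

(** A signed form of the doubled area of a triangle inscribed in the unit
circle: the left side adds the doubled areas of the triangles that the centre
forms with the sides, the right side is a product over the inscribed angles,
whose sign is visible. *)
Lemma sin_chords (a b : R) :
  sin (a *+ 2) + sin (b *+ 2) - sin ((a + b) *+ 2)
  = 4 * (sin a * sin b * sin (a + b)).
Proof.
have ca : cos a ^+ 2 = 1 - sin a ^+ 2 by rewrite -(cos2Dsin2 a) addrK.
have cb : cos b ^+ 2 = 1 - sin b ^+ 2 by rewrite -(cos2Dsin2 b) addrK.
rewrite !mulr2n !sinD !cosD.
ring: ca cb.
Qed.

Lemma cross_circle_points (c : point R) r t1 t t2 :
  cross (circle_point c r t - circle_point c r t1)
        (circle_point c r t2 - circle_point c r t1)
  = 4 * r ^+ 2 * (sin ((t - t1) / 2) * sin ((t2 - t) / 2) * sin ((t2 - t1) / 2)).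
Proof.
have := sin_chords ((t - t1) / 2) ((t2 - t) / 2).
have -> : (t - t1) / 2 + (t2 - t) / 2 = (t2 - t1) / 2 by field.
have H (x : R) : (x / 2) *+ 2 = x by rewrite -mulr_natr divfK ?pnatr_eq0.
rewrite !H => E; rewrite [4 * _]mulrC -[r ^+ 2 * 4 * _]mulrA -E !sinB.
rewrite !circle_pointE /cross !mxE /=; ring.
Qed.

(** All three half-angles lie strictly between 0 and pi, so their sines are
positive. *)
Lemma cross_circle_gt0 (c : point R) r t1 t t2 : 0 < r ->
  t1 < t -> t < t2 -> t2 < t1 + 2 * pi ->
  0 < cross (circle_point c r t - circle_point c r t1)
            (circle_point c r t2 - circle_point c r t1).
Proof.
move=> r0 h1 h2 h3; rewrite cross_circle_points.
have pi0 := pi_gt0 R.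
by rewrite !mulr_gt0 ?exprn_gt0 // sin_gt0_pi //; apply/andP; split; lra.
Qed.

Lemma unit_angle (x y : R) : x ^+ 2 + y ^+ 2 = 1 ->
  exists t, [/\ 0 <= t < 2 * pi, cos t = x & sin t = y].
Proof.
move=> xy; have x1 : -1 <= x <= 1.
  rewrite -ler_norml -(@expr_le1 _ 2) // real_normK ?num_real // -xy.
  by rewrite lerDl sqr_ge0.
have cs : cos (acos x) = x by rewrite acosK // in_itv.
have ss : sin (acos x) = `|y|.
  by rewrite sin_acos // -xy addrAC subrr add0r sqrtr_sqr.
have s0 := acos_ge0 x1; have spi := acos_lepi x1; have pi0 := pi_gt0 R.
have [y0|y0] := leP 0 y.
  exists (acos x); split => //; first by apply/andP; split; lra.
  by rewrite ss ger0_norm.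
(* With [x = 1] excluded, [acos x] is positive and [2 * pi - acos x] stays below
   [2 * pi]. *)
have xlt : -1 <= x < 1.
  case/andP: x1 => -> /=; rewrite le_eqVlt => /predU1P[x1|//].
  by move: xy; rewrite x1; nra.
have sgt := acos_gt0 xlt.
exists (2 * pi - acos x); split; first by apply/andP; split; lra.
- by rewrite cosB mulr_natl cos2pi sin2pi cs; ring.
- by rewrite sinB mulr_natl cos2pi sin2pi ss ltr0_norm //; ring.
Qed.

(** The freedom in the starting angle [t1] is what lets the angles of several
points be compared within one turn. *)
Lemma circle_angle (c p : point R) r t1 : 0 < r ->
  dot (p - c) (p - c) = r ^+ 2 ->
  exists t, t1 <= t < t1 + 2 * pi /\ p = circle_point c r t.
Proof.
move=> r0 pc; have rn0 := lt0r_neq0 r0.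
have ct : cos t1 ^+ 2 = 1 - sin t1 ^+ 2 by rewrite -(cos2Dsin2 t1) addrK.
pose x := (p - c) 0 0; pose y := (p - c) 1 0.
have xyr : y ^+ 2 = r ^+ 2 - x ^+ 2 by rewrite -pc /dot -/x -/y; ring.
(* The direction of [p] from [c], turned back by [t1]. *)
have [|s [s02 sx sy]] := @unit_angle ((x * cos t1 + y * sin t1) / r)
                                     ((y * cos t1 - x * sin t1) / r).
  by field: ct xyr.
exists (t1 + s); split; first by lra.
rewrite circle_pointE; apply/eqP; rewrite addrC -subr_eq; apply/eqP.
by apply: pointP; rewrite ?vec_x ?vec_y ?sinD ?cosD sx sy -/x -/y; field: ct.
Qed.

Lemma circumcircle p q s : cross (q - p) (s - p) != 0 ->
  exists c r, [/\ 0 < r, dot (p - c) (p - c) = r ^+ 2,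
    dot (q - c) (q - c) = r ^+ 2 & dot (s - c) (s - c) = r ^+ 2].
Proof.
set u := q - p; set v := s - p => D0.
(* The solution of the linear system [2 (c - p) . u = |u|^2],
   [2 (c - p) . v = |v|^2], by Cramer's rule. *)
pose c := p + vec ((v 1 0 * dot u u - u 1 0 * dot v v) / (2 * cross u v))
                  ((u 0 0 * dot v v - v 0 0 * dot u u) / (2 * cross u v)).
have qc : dot (q - c) (q - c) = dot (p - c) (p - c).
  have -> : q = p + u by rewrite addrC subrK.
  move: D0; rewrite /c /cross /dot !mxE /= => D0; field.
  by rewrite D0.
have sc : dot (s - c) (s - c) = dot (p - c) (p - c).
  have -> : s = p + v by rewrite addrC subrK.
  move: D0; rewrite /c /cross /dot !mxE /= => D0; field.
  by rewrite D0.
exists c, (edist p c); split; rewrite ?edist_sqr //.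
rewrite edistE sqrtr_gt0 lt0r dot_ge0 andbT dot_eq0; apply: contra D0 => pc.
move: qc sc; rewrite (eqP pc).
have -> : dot (0 : point R) 0 = 0 by apply/eqP; rewrite dot_eq0.
move=> /eqP; rewrite dot_eq0 subr_eq0 => /eqP qc _.
by rewrite /u qc -opprB (eqP pc) /cross !mxE; apply/eqP; ring.
Qed.

Lemma crossC u v : cross u v = - cross v u.
Proof. by rewrite /cross; ring. Qed.

(** Conversely, read the angles of a positively oriented triangle on its
circumcircle within one turn from the first point. Were the last point met
before the middle one, exchanging these two would give a triangle that is both
in counterclockwise order and negatively oriented. *)
Lemma SD_orient m : SD m <-> 0 < orient m.
Proof.
case: m => p1 p p2; split.
  move=> [c [r [t1 [t [t2 [/= r0 [h1 h2 h3] -> -> ->]]]]]].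
  exact: cross_circle_gt0.
rewrite /orient /= => o0.
have [c [r [r0 p1r pr p2r]]] := circumcircle (lt0r_neq0 o0).
have [t1 [_ p1E]] := circle_angle 0 r0 p1r.
have [t [/andP[t1t tlt] pE]] := circle_angle t1 r0 pr.
have [t2 [/andP[t1t2 t2lt] p2E]] := circle_angle t1 r0 p2r.
have cross0l u : cross 0 u = 0 by rewrite /cross !mxE; ring.
exists c, r, t1, t, t2; split => //; split => //.
- rewrite lt_neqAle t1t andbT; apply/eqP => e.
  by move: o0; rewrite pE p1E e subrr cross0l ltxx.
- rewrite ltNge le_eqVlt; apply/negP => /predU1P[e|t2t].
    by move: o0; rewrite pE p2E e /cross [X in 0 < X](_ : _ = 0) ?ltxx //; ring.
  have t1t2' : t1 < t2.
    rewrite lt_neqAle t1t2 andbT; apply/eqP => e.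
    by move: o0; rewrite crossC p2E p1E e subrr cross0l oppr0 ltxx.
  have := cross_circle_gt0 c r0 t1t2' t2t tlt.
  by rewrite -p1E -pE -p2E crossC oppr_gt0 ltNge (ltW o0).
Qed.

End Circles.

(** * Congruence classes and signed heights *)

Section Classes.
Variable R : realType.
Implicit Types (kappa d h : R) (m : mesh R).

(** The apex lies below the horizontal chord when [h] is positive, because the
path turns counterclockwise exactly when its middle point is to the right of the
chord. *)
Definition triangle d h : mesh R := Mesh 0 (vec (d / 2) (- h)) (vec d 0).

(** The equation [kappa = 2 |h| / b^2] for the equal side [b], where
[b^2 = (d / 2)^2 + h^2] by Pythagoras, with the denominator cleared. *)
Definition heights kappa d : set R :=
  [set h | kappa * ((d / 2) ^+ 2 + h ^+ 2) = 2 * `|h|].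

Lemma distance_triangle d h : 0 < d -> distance (triangle d h) = d.
Proof.
move=> d0; rewrite /distance edistE /dot !mxE /=.
rewrite [X in Num.sqrt X](_ : _ = d ^+ 2); last by ring.
by rewrite sqrtr_sqr gtr0_norm.
Qed.

Lemma orient_triangle d h : orient (triangle d h) = h * d.
Proof. by rewrite /orient /cross !mxE /=; ring. Qed.

Lemma ordinary_triangle d h : 0 < d -> ordinary (triangle d h).
Proof.
move=> d0 /(congr1 (fun p : point R => p 0 0)); rewrite /= !mxE /= => e.
by move: d0; rewrite -e ltxx.
Qed.

Lemma equally_spaced_triangle d h : equally_spaced (triangle d h).
Proof. by apply: edist_eq; rewrite /dot !mxE /=; field. Qed.

(** Pythagoras in half of the isosceles triangle: the foot of the altitude is
the midpoint of the chord, and the height is the doubled area over the chord. *)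
Lemma side_sqr m : ordinary m -> equally_spaced m ->
  edist (pfirst m) (pmid m) ^+ 2
  = (distance m / 2) ^+ 2 + (orient m / distance m) ^+ 2.
Proof.
move=> /distance_gt0 /lt0r_neq0 d0; rewrite /equally_spaced => es.
have := dot_side (pfirst m) (pmid m) (plast m).
rewrite es addrAC subrr add0r -/(distance m) => E.
have := lagrange (pmid m - pfirst m) (plast m - pfirst m).
have dE p q : dot (p - q) (p - q) = edist q p ^+ 2.
  by rewrite edist_sqr /dot !mxE; ring.
rewrite !dE -/(orient m) -/(distance m) es.
move: (dot _ _) E => k E.
move: (orient m) (edist _ _) (distance m) d0 E => w e d d0 E L.
have kE : k = d ^+ 2 / 2 by rewrite -E; field.
apply: (mulIf (expf_neq0 2 d0)); rewrite -L kE; field.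
by rewrite d0.
Qed.

Lemma curvatureE m : ordinary m -> equally_spaced m ->
  curvature m = 2 * `|orient m / distance m|
                / ((distance m / 2) ^+ 2 + (orient m / distance m) ^+ 2).
Proof.
move=> om es; have d0 := distance_gt0 om.
rewrite -side_sqr // /curvature /area det_row_mx -/(orient m) -/(distance m).
rewrite -es normrM normfV (gtr0_norm d0).
have e0 : edist (pfirst m) (pmid m) != 0.
  rewrite -sqrf_eq0 side_sqr // lt0r_neq0 // ltr_wpDr ?sqr_ge0 // exprn_gt0 //.
  by rewrite divr_gt0.
by field; rewrite e0 lt0r_neq0.
Qed.

Lemma heightsP kappa d m : ordinary m -> equally_spaced m -> distance m = d ->
  curvature m = kappa <-> heights kappa d (orient m / d).
Proof.
move=> om es md; rewrite curvatureE // md /heights /=.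
have d0 : 0 < d by rewrite -md distance_gt0.
have B0 : (d / 2) ^+ 2 + (orient m / d) ^+ 2 != 0.
  by rewrite lt0r_neq0 // ltr_wpDr ?sqr_ge0 // exprn_gt0 // divr_gt0.
split=> [<-|<-]; first by rewrite divfK.
by rewrite mulfK.
Qed.

Definition class_of d h := congruence_class (triangle d h).

(** The chord and the signed height determine the equal sides by [side_sqr], so
they determine all the invariants of [congruentP]. *)
Lemma class_of_mesh m d : ordinary m -> equally_spaced m -> distance m = d ->
  congruence_class m = class_of d (orient m / d).
Proof.
move=> om es md; have d0 : 0 < d by rewrite -md distance_gt0.
have ot := @ordinary_triangle d (orient m / d) d0.
have tm : congruent (triangle d (orient m / d)) m.
  have et := equally_spaced_triangle d (orient m / d).
  have e : edist (pfirst (triangle d (orient m / d)))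
                 (pmid (triangle d (orient m / d)))
         = edist (pfirst m) (pmid m).
    apply/eqP; rewrite -(@eqrXn2 _ 2) ?edist_ge0 //.
    rewrite !side_sqr // distance_triangle // orient_triangle md.
    by rewrite mulfK ?lt0r_neq0.
  apply/(congruentP _ ot); split => //; first by rewrite -et -es.
    by rewrite distance_triangle.
  by rewrite orient_triangle divfK ?lt0r_neq0.
exact/esym/congruence_class_eq.
Qed.

Lemma class_of_refl d h : 0 < d -> class_of d h (triangle d h).
Proof. by move=> d0; apply/congruentP => //; apply: ordinary_triangle. Qed.

Lemma class_of_inj d : 0 < d -> injective (class_of d).
Proof.
move=> d0 h h' e; have := class_of_refl h' d0; rewrite -e.
case/(congruentP _ (@ordinary_triangle d h d0)) => _ _ _.
by rewrite !orient_triangle => /mulIf; apply; apply: lt0r_neq0.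
Qed.

(** With [class_of_inj], this reduces the counting of classes to the counting of
the roots of a real equation. *)
Lemma classesE kappa d : 0 < d ->
  classes kappa d = class_of d @` heights kappa d.
Proof.
move=> d0; apply/seteqP; split => C.
  move=> [m [om es km md] <-]; exists (orient m / d).
    exact/(heightsP kappa om es md).
  by rewrite -class_of_mesh.
move=> [h hh <-]; exists (triangle d h) => //.
have td := distance_triangle h d0; have ot := @ordinary_triangle d h d0.
have et := equally_spaced_triangle d h.
split => //; apply/(heightsP kappa ot et td).
by rewrite orient_triangle mulfK ?lt0r_neq0.
Qed.

(** A set of meshes that is described by the signed height is a union of
congruence classes, so whether it includes a class can be read off the standard
triangle of that class. *)
Lemma classes_inE (S : set (mesh R)) (P : set R) kappa d : 0 < d ->
  (forall m, distance m = d -> S m <-> P (orient m / d)) ->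
  classes_in S kappa d = class_of d @` (heights kappa d `&` P).
Proof.
move=> d0 SP; have dn0 := lt0r_neq0 d0.
rewrite /classes_in classesE //; apply/seteqP; split => C.
  move=> [[h hh <-] CS]; exists h => //; split => //.
  have := CS _ (class_of_refl h d0) => /SP.
  by rewrite distance_triangle // orient_triangle mulfK //; apply.
move=> [h [hh Ph] <-]; split; first by exists h.
move=> m /(congruentP _ (@ordinary_triangle d h d0))[_ _ e3 e4].
by apply/SP; rewrite -?e3 ?distance_triangle // -e4 orient_triangle mulfK.
Qed.

Lemma classes_inSD kappa d : 0 < d ->
  classes_in SD kappa d = class_of d @` (heights kappa d `&` [set h | 0 < h]).
Proof.
move=> d0; apply: classes_inE => // m _; rewrite SD_orient /=.
by rewrite pmulr_lgt0 ?invr_gt0.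
Qed.

Lemma classes_inNSD kappa d : 0 < d ->
  classes_in (~` SD) kappa d
  = class_of d @` (heights kappa d `&` [set h | h <= 0]).
Proof.
move=> d0; apply: classes_inE => // m _; rewrite /setC /= SD_orient.
by rewrite pmulr_lle0 ?invr_gt0 // leNgt; split => [/negP|/negP].
Qed.

(** * The equation for the heights *)

(** Completing the square: the right side decides by its sign how many heights
there are. *)
Lemma heights_gap kappa d h : 0 < kappa ->
  heights kappa d h <-> (kappa * `|h| - 1) ^+ 2 = 1 - (kappa * d / 2) ^+ 2.
Proof.
move=> k0; rewrite /heights /= -(real_normK (num_real h)).
move: `|h| => a; split => H; last first.
  apply: (mulfI (lt0r_neq0 k0)).
  have -> : kappa * (2 * a)
            = kappa ^+ 2 * a ^+ 2 + 1 - (kappa * a - 1) ^+ 2 by ring.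
  by rewrite H; field.
have -> : (kappa * a - 1) ^+ 2
          = kappa ^+ 2 * a ^+ 2 - kappa * (2 * a) + 1 by ring.
by rewrite -H; field.
Qed.

Lemma heights_eq0 kappa d : 0 < kappa -> 2 < kappa * d -> heights kappa d = set0.
Proof.
move=> k0 kd; apply/seteqP; split => // h /(heights_gap _ _ k0) e.
have := sqr_ge0 (kappa * `|h| - 1); rewrite e leNgt; apply/negP; rewrite negbK.
nra.
Qed.

(** In units of the circumradius, the distance from the circumcentre to the
chord: the two isosceles triangles inscribed on this chord in a circle of radius
[1 / kappa] have their apices at the two ends of the diameter orthogonal to it,
so their heights are [tall] and [flat]. *)
Definition gap kappa d := Num.sqrt (1 - (kappa * d / 2) ^+ 2).
Definition tall kappa d := (1 + gap kappa d) / kappa.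
Definition flat kappa d := (1 - gap kappa d) / kappa.

Section Heights.
Variables (kappa d : R).
Hypotheses (k0 : 0 < kappa) (d0 : 0 < d) (kd2 : kappa * d <= 2).

Let half_gt0 : 0 < kappa * d / 2. Proof. by rewrite divr_gt0 // mulr_gt0. Qed.

Lemma gap_sqr : gap kappa d ^+ 2 = 1 - (kappa * d / 2) ^+ 2.
Proof.
rewrite sqr_sqrtr // subr_ge0 exprn_ile1 ?(ltW half_gt0) //.
by rewrite ler_pdivrMr // mul1r.
Qed.

Lemma gap_lt1 : gap kappa d < 1.
Proof. by rewrite -(@expr_lt1 _ 2) ?sqrtr_ge0 // gap_sqr gtrBl exprn_gt0. Qed.

Lemma tall_gt0 : 0 < tall kappa d.
Proof. by rewrite divr_gt0 // ltr_pwDl ?sqrtr_ge0. Qed.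

Lemma flat_gt0 : 0 < flat kappa d.
Proof. by rewrite divr_gt0 // subr_gt0 gap_lt1. Qed.

Lemma heights_norm h :
  heights kappa d h <-> `|h| = tall kappa d \/ `|h| = flat kappa d.
Proof.
rewrite heights_gap // -gap_sqr; have kn0 := lt0r_neq0 k0.
split=> [/eqP|[->|->]].
- rewrite eqf_sqr => /orP[] /eqP e; [left|right]; apply: (mulfI kn0);
    rewrite [RHS]mulrC /tall /flat divfK //; lra.
- by rewrite /tall; field.
- by rewrite /flat; field.
Qed.

Lemma heights_pos :
  heights kappa d `&` [set h | 0 < h] = [set` [:: tall kappa d; flat kappa d]].
Proof.
apply/seteqP; split => h /=; rewrite !inE.
  move=> [/heights_norm + h0]; rewrite gtr0_norm //.
  by move=> -[] ->; rewrite eqxx ?orbT.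
move=> H; have h0 : 0 < h.
  by case/orP: H => /eqP ->; [exact: tall_gt0|exact: flat_gt0].
split => //; apply/heights_norm; rewrite gtr0_norm //.
by case/orP: H => /eqP ->; [left|right].
Qed.

Lemma heights_npos :
  heights kappa d `&` [set h | h <= 0]
  = [set` [:: - tall kappa d; - flat kappa d]].
Proof.
apply/seteqP; split => h /=; rewrite !inE.
  move=> [/heights_norm + h0]; rewrite ler0_norm //.
  by move=> -[] /eqP; rewrite eqr_oppLR => ->; rewrite ?orbT.
move=> H; have h0 : h <= 0.
  by case/orP: H => /eqP ->; rewrite oppr_le0 ltW ?tall_gt0 ?flat_gt0.
split => //; apply/heights_norm; rewrite ler0_norm //.
by case/orP: H => /eqP ->; rewrite opprK; [left|right].
Qed.

Lemma heightsE : heights kappa d =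
  [set` [:: tall kappa d; flat kappa d; - tall kappa d; - flat kappa d]].
Proof.
have -> : heights kappa d = (heights kappa d `&` [set h | 0 < h])
                            `|` (heights kappa d `&` [set h | h <= 0]).
  rewrite -setIUr; apply/seteqP; split => h; last by case.
  by move=> hh; split => //=; case: ltP; [left|right].
rewrite heights_pos heights_npos; apply/seteqP; split => h /=; rewrite !inE.
  by case=> /orP[] ->; rewrite ?orbT.
by move=> /or4P[] ->; rewrite ?orbT; auto.
Qed.

End Heights.

Lemma gap_eq0 kappa d : kappa * d = 2 -> gap kappa d = 0.
Proof. by move=> kd; rewrite /gap kd divff ?pnatr_eq0 // expr1n subrr sqrtr0. Qed.

Lemma gap_gt0 kappa d : 0 < kappa -> 0 < d -> kappa * d < 2 -> 0 < gap kappa d.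
Proof.
move=> k0 d0 kd; rewrite sqrtr_gt0 subr_gt0 exprn_ilt1 //.
  by rewrite ltW // divr_gt0 // mulr_gt0.
by rewrite ltr_pdivrMr // mul1r.
Qed.

Lemma flat_lt_tall kappa d : 0 < kappa -> 0 < d -> kappa * d < 2 ->
  flat kappa d < tall kappa d.
Proof.
move=> k0 d0 kd; rewrite ltr_pM2r ?invr_gt0 //.
by have := gap_gt0 k0 d0 kd; lra.
Qed.

End Classes.

(** * Counting *)

Section Counting.
Variable R : realType.
Implicit Types (kappa d : R).

Lemma card_seq (T : choiceType) (s : seq T) : uniq s -> [set` s] #= `I_(size s).
Proof.
move=> us.
have -> : [set` s] = [set` [fset x in s]%fset].
  by apply/seteqP; split => x /=; rewrite inE.
by apply/card_eq_fsetP; rewrite card_fseq undup_id.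
Qed.

Lemma card_seq_le (T : choiceType) (s : seq T) : [set` s] #<= `I_(size s).
Proof.
have -> : [set` s] = [set` undup s].
  by apply/seteqP; split => x /=; rewrite mem_undup.
by rewrite (card_le_eql (card_seq (undup_uniq s))) card_le_II size_undup.
Qed.

Lemma card_class_image d (A : set R) (s : seq R) : 0 < d -> A = [set` s] ->
  uniq s -> class_of d @` A #= `I_(size s).
Proof.
move=> d0 -> us; apply: card_eq_trans (card_seq us).
by apply: inj_card_eq => x y _ _; apply: class_of_inj.
Qed.

(** A negative distance or curvature is impossible, and a zero distance is
excluded by ordinarity. Zero curvature leaves the height 0 only, which is the
case of collinear points. *)
Lemma classes_le4 kappa d : classes kappa d #<= `I_4.
Proof.
have [d0|d0] := ltP 0 d; last first.
  rewrite (_ : classes _ _ = set0) ?card_ge0 //.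
  apply/seteqP; split => // C [m [om _ _ md] _].
  by have := distance_gt0 om; rewrite md ltNge d0.
rewrite classesE //.
have [k0|k0|k0] := ltgtP kappa 0.
- rewrite (_ : heights _ _ = set0) ?image_set0 ?card_ge0 //.
  apply/seteqP; split => // h; rewrite /heights /= => e.
  have : 0 <= 2 * `|h| by rewrite mulr_ge0.
  rewrite -e nmulr_rge0 // leNgt; apply/negP; rewrite negbK.
  by rewrite ltr_wpDr ?sqr_ge0 // exprn_gt0 // divr_gt0.
- have [kd|kd] := leP (kappa * d) 2; last first.
    by rewrite heights_eq0 // image_set0 card_ge0.
  rewrite heightsE //; apply: card_le_trans (card_image_le _ _) _.
  exact: (card_seq_le [:: _; _; _; _]).
- have h0 : heights kappa d = [set` [:: 0]].
    apply/seteqP; split => h; rewrite /heights /= inE k0 mul0r.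
      by move/esym/eqP; rewrite mulf_eq0 pnatr_eq0 /= normr_eq0.
    by move=> /eqP ->; rewrite normr0 mulr0.
  rewrite h0; apply: card_le_trans (card_image_le _ _) _.
  apply: card_le_trans (card_seq_le _) _.
  by rewrite card_le_II.
Qed.

End Counting.

Theorem theorem4p11 (R : realType) (kappa d : R) :
  classes kappa d #<= `I_4 /\
  (0 < kappa -> 0 < d ->
    (kappa * d = 2 ->
      [/\ classes kappa d #= `I_2,
          classes_in SD kappa d #= `I_1
        & classes_in (~` SD) kappa d #= `I_1]) /\
    (kappa * d <> 2 ->
      (kappa * d < 2 ->
        [/\ classes kappa d #= `I_4,
            classes_in SD kappa d #= `I_2
          & classes_in (~` SD) kappa d #= `I_2]) /\
      (2 < kappa * d -> classes kappa d = set0))).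
Proof.
split; first exact: classes_le4.
move=> k0 d0; rewrite classes_inSD // classes_inNSD // classesE //.
split=> [kd|_]; last split=> kd.
- have kd2 : kappa * d <= 2 by rewrite kd.
  have nf : flat kappa d = tall kappa d.
    by rewrite /flat /tall gap_eq0 // subr0 addr0.
  have f0 := tall_gt0 d k0.
  have dup (x : R) : [set` [:: x; x]] = [set` [:: x]].
    by apply/seteqP; split => y /=; rewrite !inE ?orbb.
  split.
  + apply: (@card_class_image _ _ _ [:: tall kappa d; - tall kappa d]) => //.
      rewrite heightsE // nf; apply/seteqP; split => y /=; rewrite !inE.
        by rewrite orbb orbA orbb.
      by case/orP => ->; rewrite ?orbT.
    by rewrite /= inE andbT; apply/eqP; lra.
  + apply: (@card_class_image _ _ _ [:: tall kappa d]) => //.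
    by rewrite heights_pos // nf dup.
  + apply: (@card_class_image _ _ _ [:: - tall kappa d]) => //.
    by rewrite heights_npos // nf dup.
- have kd2 := ltW kd.
  have n0 := flat_gt0 k0 d0 kd2; have nf := flat_lt_tall k0 d0 kd.
  split.
  + apply: (card_class_image d0 (heightsE k0 d0 kd2)).
    by rewrite /= !inE !negb_or !andbT; do !(apply/andP; split); apply/eqP; lra.
  + apply: (card_class_image d0 (heights_pos k0 d0 kd2)).
    by rewrite /= inE andbT; apply/eqP; lra.
  + apply: (card_class_image d0 (heights_npos k0 d0 kd2)).
    by rewrite /= inE andbT; apply/eqP; lra.
- by rewrite heights_eq0 // image_set0.
Qed.
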